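(* Let $(M,d)$ be a complete pointed metric space with base point $0$, and let $\phi\in \mathrm{Lip}_0(M)^*$. Then $\phi$ is normal if and only if $\phi$ is weak$^*$ continuous, i.e. if and only if $\phi\in\mathcal{F}(M)$.
   Context: $\mathrm{Lip}_0(M)$ is the Banach space of all real-valued Lipschitz functions $f$ on $M$ with $f(0)=0$, with norm $\|f\|_L=\sup\{|f(x)-f(y)|/d(x,y): x\neq y\in M\}$, and $\mathrm{Lip}_0(M)^*$ is its dual Banach space. For $x\in M$, $\delta(x)\in\mathrm{Lip}_0(M)^*$ is the evaluation functional $f\mapsto f(x)$. The Lipschitz-free space is $\mathcal{F}(M)=\overline{\mathrm{span}}\{\delta(x):x\in M\}\subset\mathrm{Lip}_0(M)^*$ (norm closure). It is the canonical predual of $\mathrm{Lip}_0(M)$. ''Weak$^*$ continuous'' means continuous for the weak$^*$ topology on $\mathrm{Lip}_0(M)$ induced by $\mathcal{F}(M)$, equivalently $\phi\in\mathcal{F}(M)$. Definition (normal). A functional $\phi\in\mathrm{Lip}_0(M)^*$ is normal if for every norm-bounded net $(f_i)$ in $\mathrm{Lip}_0(M)$ that converges pointwise and monotonically to some $f\in\mathrm{Lip}_0(M)$, one has $\langle f_i,\phi\rangle\to\langle f,\phi\rangle$. Equivalently, $\langle f_i,\phi\rangle\to 0$ for every net $(f_i)$ of non-negative functions in the closed unit ball of $\mathrm{Lip}_0(M)$ that decreases pointwise to $0$. *)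

(* Defs.v *)
From HB Require Import structures.
From mathcomp Require Import all_boot all_order all_algebra.
From mathcomp Require Import all_classical all_reals all_analysis.

Set Implicit Arguments.
Unset Strict Implicit.
Unset Printing Implicit Defensive.

Import Order.TTheory GRing.Theory Num.Theory.
Import numFieldNormedType.Exports.

Local Open Scope classical_set_scope.
Local Open Scope ring_scope.

(* The library's [point] serves as the base point of a pointed metric space;
   [completeType] already contains a point. *)
#[short(type="pointedMetricType")]
HB.structure Definition PointedMetric (R : numDomainType) :=
  {M of Metric R M & PseudoPointedMetric R M}.

#[short(type="completePointedMetricType")]
HB.structure Definition CompletePointedMetric (R : numDomainType) :=
  {M of PointedMetric R M & Complete M}.

Section lip0.
Context {R : realType} (M : pointedMetricType R).

Definition is_lip0 (f : M -> R) : Prop :=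
  f point = 0 /\
  exists k : R, forall x y : M, `|f x - f y| <= k * mdist x y.

Definition lip0_pred : {pred M -> R} := [pred f | `[< is_lip0 f >]].

Lemma lip0_pred_submod : submod_closed lip0_pred.
Proof.
split=> [|a f g /asboolP[f0 [k fk]] /asboolP[g0 [l gl]]]; apply/asboolP.
  by split=> //; exists 0 => x y; rewrite subrr normr0 mul0r.
split; first by rewrite /= !fctE /= f0 g0 scaler0 addr0.
exists (`|a| * k + l) => x y; rewrite !fctE /= mulrDl -mulrA.
rewrite opprD addrACA -scalerBr (le_trans (ler_normD _ _))// lerD//.
by rewrite normrM ler_wpM2l.
Qed.

HB.instance Definition _ :=
  GRing.isSubmodClosed.Build R (M -> R) lip0_pred lip0_pred_submod.

Record Lip0 := MkLip0 { lip0_fun :> M -> R; _ : lip0_fun \in lip0_pred }.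

HB.instance Definition _ := [isSub for lip0_fun].
HB.instance Definition _ := [Choice of Lip0 by <:].
HB.instance Definition _ := [SubChoice_isSubLmodule of Lip0 by <:].

(* When M is a singleton the set is empty and [sup set0 = 0]. *)
Definition lip_norm (f : Lip0) : R :=
  sup [set `|f p.1 - f p.2| / mdist p.1 p.2 | p in [set p | p.1 != p.2]].

Lemma lip0_base (f : Lip0) : f point = 0.
Proof. by have /asboolP[] := valP f. Qed.

Lemma lip_normP (f : Lip0) (x y : M) :
  `|f x - f y| <= lip_norm f * mdist x y.
Proof.
have [->|xy] := eqVneq x y; first by rewrite subrr normr0 mdistxx mulr0.
rewrite -ler_pdivrMr ?mdist_gt0//; apply: ub_le_sup; last by exists (x, y).
have /asboolP[_ [k fk]] := valP f; exists k => _ [[u v] /= uv <-].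
by rewrite ler_pdivrMr ?mdist_gt0.
Qed.

Lemma lip_norm_le (f : Lip0) (k : R) : 0 <= k ->
  (forall x y : M, `|f x - f y| <= k * mdist x y) -> lip_norm f <= k.
Proof.
move=> k0 fk; rewrite /lip_norm; set A := [set _ | _ in _].
have [->|/set0P A0] := eqVneq A set0; first by rewrite sup0.
by apply: ge_sup => // _ [[u v] /= uv <-]; rewrite ler_pdivrMr ?mdist_gt0.
Qed.

Lemma lip_norm_ge0 (f : Lip0) : 0 <= lip_norm f.
Proof.
pose A := [set `|f p.1 - f p.2| / mdist p.1 p.2 | p in [set p | p.1 != p.2]].
have [A0|/set0P[_ [[u v] /= uv _]]] := eqVneq A set0.
  by rewrite /lip_norm -/A A0 sup0.
rewrite -(pmulr_lge0 _ (_ : 0 < mdist u v)) ?mdist_gt0//.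
exact: le_trans (lip_normP f u v).
Qed.

Lemma ler_lip_normD (f g : Lip0) : lip_norm (f + g) <= lip_norm f + lip_norm g.
Proof.
apply: lip_norm_le => [|x y]; first by rewrite addr_ge0 ?lip_norm_ge0.
rewrite /= !fctE opprD addrACA mulrDl (le_trans (ler_normD _ _))//.
by rewrite lerD ?lip_normP.
Qed.

Lemma lip_normZ (a : R) (f : Lip0) : lip_norm (a *: f) = `|a| * lip_norm f.
Proof.
have le b g : lip_norm (b *: g) <= `|b| * lip_norm g.
  apply: lip_norm_le => [|x y]; first by rewrite mulr_ge0 ?lip_norm_ge0.
  by rewrite /= !fctE -scalerBr normrM -mulrA ler_wpM2l ?lip_normP.
apply/eqP; rewrite eq_le le /=; have [->|a0] := eqVneq a 0.
  by rewrite normr0 mul0r lip_norm_ge0.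
by rewrite -ler_pdivlMl ?normr_gt0// -normfV -{1}(scalerK a0 f) le.
Qed.

Lemma lip_norm_eq0 (f : Lip0) : lip_norm f = 0 -> f = 0.
Proof.
move=> f0; apply: val_inj; apply/funext => x /=.
have := lip_normP f x point; rewrite f0 mul0r lip0_base subr0 normr_le0.
by move/eqP.
Qed.

HB.instance Definition _ := Lmodule_isNormed.Build R Lip0
  ler_lip_normD lip_normZ lip_norm_eq0.

Lemma lip0_normE (f : Lip0) : `|f| = lip_norm f. Proof. by []. Qed.

End lip0.

Section dual.
Context {R : realType} (V : normedModType R).

Definition dual_pred : {pred V -> R} :=
  [pred phi : V -> R | `[< scalar phi /\ continuous phi >]].

Lemma dual_pred_submod : submod_closed dual_pred.
Proof.
split=> [|a f g /asboolP[fl fc] /asboolP[gl gc]]; apply/asboolP.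
  split=> [b u v|]; last exact: cst_continuous.
  by rewrite /= mulr0 addr0.
split=> [b u v|x].
  rewrite !fctE /= fl gl -![a *: _]/(a * _) !mulrDr addrACA.
  by rewrite [a * (b * _)]mulrCA.
by apply: (@cvgD _ R); [apply: (@cvgZr _ R); exact: fc|exact: gc].
Qed.

HB.instance Definition _ :=
  GRing.isSubmodClosed.Build R (V -> R) dual_pred dual_pred_submod.

Record dual := MkDual { dual_fun :> V -> R; _ : dual_fun \in dual_pred }.

HB.instance Definition _ := [isSub for dual_fun].
HB.instance Definition _ := [Choice of dual by <:].
HB.instance Definition _ := [SubChoice_isSubLmodule of dual by <:].

Lemma dual_scalar (phi : dual) : scalar phi.
Proof. by have /asboolP[] := valP phi. Qed.

Lemma dual_continuous (phi : dual) : continuous phi.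
Proof. by have /asboolP[] := valP phi. Qed.

HB.instance Definition _ (phi : dual) :=
  GRing.isLinear.Build R V R *%R phi (dual_scalar phi).

(* The operator norm; its metric topology is the one in which the closure
   defining [lipfree] is taken. *)
Definition dual_norm (phi : dual) : R :=
  sup [set `|phi v| | v in [set v : V | `|v| <= 1]].

Let A (phi : dual) := [set `|phi v| | v in [set v : V | `|v| <= 1]].

Let A_neq0 phi : A phi !=set0.
Proof. by exists `|phi 0|; exists 0 => //=; rewrite normr0. Qed.

Lemma dual_normP (phi : dual) (v : V) : `|phi v| <= dual_norm phi * `|v|.
Proof.
have [->|v0] := eqVneq v 0; first by rewrite linear0 !normr0 mulr0.
rewrite -ler_pdivrMr ?normr_gt0//; apply: ub_le_sup.
  have [k k0 phik] := linear_lipschitz (@dual_continuous phi).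
  exists k => _ [w /= w1 <-].
  by rewrite (le_trans (phik _))// -[leRHS]mulr1 ler_pM2l.
exists (`|v|^-1 *: v) => /=.
  by rewrite normrZ normfV normr_id mulVf ?normr_eq0.
by rewrite linearZ /= normrM normfV normr_id mulrC.
Qed.

Lemma dual_norm_le (phi : dual) (k : R) : 0 <= k ->
  (forall v : V, `|phi v| <= k * `|v|) -> dual_norm phi <= k.
Proof.
move=> k0 phik; apply: ge_sup; first exact: A_neq0.
move=> _ [v /= v1 <-]; rewrite (le_trans (phik _))// -[leRHS]mulr1.
by rewrite ler_wpM2l.
Qed.

Lemma dual_norm_ge0 (phi : dual) : 0 <= dual_norm phi.
Proof.
apply: ub_le_sup; last by exists 0 => /=; rewrite ?linear0 normr0.
have [k k0 phik] := linear_lipschitz (@dual_continuous phi).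
exists k => _ [w /= w1 <-].
by rewrite (le_trans (phik _))// -[leRHS]mulr1 ler_pM2l.
Qed.

Lemma ler_dual_normD (phi psi : dual) :
  dual_norm (phi + psi) <= dual_norm phi + dual_norm psi.
Proof.
apply: dual_norm_le => [|v]; first by rewrite addr_ge0 ?dual_norm_ge0.
by rewrite /= !fctE mulrDl (le_trans (ler_normD _ _))// lerD ?dual_normP.
Qed.

Lemma dual_normZ (a : R) (phi : dual) :
  dual_norm (a *: phi) = `|a| * dual_norm phi.
Proof.
have le b g : dual_norm (b *: g) <= `|b| * dual_norm g.
  apply: dual_norm_le => [|v]; first by rewrite mulr_ge0 ?dual_norm_ge0.
  by rewrite /= !fctE normrM -mulrA ler_wpM2l ?dual_normP.
apply/eqP; rewrite eq_le le /=; have [->|a0] := eqVneq a 0.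
  by rewrite normr0 mul0r dual_norm_ge0.
by rewrite -ler_pdivlMl ?normr_gt0// -normfV -{1}(scalerK a0 phi) le.
Qed.

Lemma dual_norm_eq0 (phi : dual) : dual_norm phi = 0 -> phi = 0.
Proof.
move=> phi0; apply: val_inj; apply/funext => v /=.
by have := dual_normP phi v; rewrite phi0 mul0r normr_le0 => /eqP.
Qed.

HB.instance Definition _ := Lmodule_isNormed.Build R dual
  ler_dual_normD dual_normZ dual_norm_eq0.

Lemma dual_normE (phi : dual) : `|phi| = dual_norm phi. Proof. by []. Qed.

Definition linear_span (A : set V) : set V :=
  [set v | exists (n : nat) (c : 'I_n -> R) (a : 'I_n -> V),
    (forall i, A (a i)) /\ v = \sum_(i < n) c i *: a i].

(* The topology on V generated by the family F of functionals: it is induced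
   by the map sending v to the family of values (psi v), psi in F, into the
   product space. *)
Definition dual_pair_topology (F : set dual) : Type :=
  initial_topology (fun (v : V) => (fun psi : F => val psi v) : {ptws F -> R}).

HB.instance Definition _ (F : set dual) :=
  Topological.on (dual_pair_topology F).

End dual.

Section lipfree.
Context {R : realType} (M : pointedMetricType R).

Definition evaluation (x : M) (f : Lip0 M) : R := f x.

Lemma evaluation_dual (x : M) : evaluation x \in @dual_pred R (Lip0 M).
Proof.
apply/asboolP; split=> [a f g|]; first by rewrite /evaluation /= !fctE.
have evl : linear (evaluation x : Lip0 M -> R^o).
  by move=> a f g; rewrite /evaluation /= !fctE.
pose ev : {linear Lip0 M -> R^o} :=
  HB.pack (evaluation x : Lip0 M -> R^o) (GRing.isLinear.Build _ _ _ _ _ evl).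
apply: (@bounded_linear_continuous R (Lip0 M) R^o ev).
apply/linear_boundedP; near=> k => f; rewrite /= /evaluation.
have := lip_normP f x point; rewrite lip0_base subr0 => /le_trans; apply.
by rewrite mulrC ler_wpM2r ?lip_norm_ge0.
Unshelve. all: by end_near. Qed.

Definition delta (x : M) : dual (Lip0 M) := MkDual (evaluation_dual x).

Definition lipfree : set (dual (Lip0 M)) :=
  closure (linear_span (range delta)).

Definition weak_star : Type := dual_pair_topology lipfree.

HB.instance Definition _ := Topological.on weak_star.

Definition weak_star_continuous (phi : dual (Lip0 M)) : Prop :=
  continuous (phi : weak_star -> R).

End lipfree.

Arguments lipfree {R} M.
Arguments weak_star {R} M.

Section normal.
Context {R : realType}.

Definition directed (I : Type) (le : I -> I -> Prop) : Prop :=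
  [/\ inhabited I,
      forall i, le i i,
      forall i j k, le i j -> le j k -> le i k &
      forall i j, exists k, le i k /\ le j k].

(* Convergence of a net is convergence along the filter generated by its
   tails. *)
Definition eventually_along (I : Type) (le : I -> I -> Prop) : set_system I :=
  filter_from [set: I] (fun i => [set j | le i j]).

Lemma eventually_along_proper (I : Type) (le : I -> I -> Prop) :
  directed le -> ProperFilter (eventually_along le).
Proof.
case=> -[i0] lexx letr ub; apply: filter_from_proper => [|i _]; last first.
  by exists i; exact: lexx.
apply: filter_from_filter => [|i j _ _]; first by exists i0.
by have [k [ik jk]] := ub i j; exists k => // l /= kl; split; exact: letr kl.
Qed.

Definition monotone_net (M : pointedMetricType R) (I : Type)
    (le : I -> I -> Prop) (f : I -> Lip0 M) : Prop :=
  (forall i j, le i j -> forall x, f i x <= f j x) \/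
  (forall i j, le i j -> forall x, f j x <= f i x).

Definition normal (M : pointedMetricType R) (phi : dual (Lip0 M)) : Prop :=
  forall (I : Type) (le : I -> I -> Prop) (f : I -> Lip0 M) (g : Lip0 M),
    directed le ->
    (exists C : R, forall i, `|f i| <= C) ->
    monotone_net le f ->
    (forall x, f i x @[i --> eventually_along le] --> g x) ->
    phi (f i) @[i --> eventually_along le] --> phi g.

End normal.

(* Main.v *)
(* The point is that a normal functional [phi] is small on the unit ball of
   functions vanishing on a suitable finite set.  Let [s(F)] be the supremum of
   [phi] over the nonnegative functions of the unit ball vanishing on [F], and
   let [a] be the infimum of [s(F)] over finite [F].  Since
     [phi (max (f, g)) + phi (min (f, g)) = phi f + phi g],
   near-maximizers are stable under max and min up to a small error, so that
   suitable near-maximizers [f_k] on an increasing sequence of sets [F_k] have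
   [phi (limsup_k f_k) >= lim_k s(F_k)] by normality.  Hence, if the [F_k] are
   finite with [s(F_k) --> a], then [a] is attained on the union [U] of the
   [F_k], and even on [U] with any further point added.  The maximizers for [U]
   are closed under min and for each point contain a function vanishing there:
   ordered downwards they form a net decreasing to [0] on which [phi] equals
   [a], whence [a = 0].  A finite-codimensional Hahn-Banach argument then moves
   [phi] to the span of the evaluations by a small perturbation. *)

Require Import Defs.
From HB Require Import structures.
From mathcomp Require Import all_boot all_order all_algebra.
From mathcomp Require Import all_classical all_reals all_analysis.
From mathcomp Require Import lra.

Set Implicit Arguments.
Unset Strict Implicit.
Unset Printing Implicit Defensive.

Import Order.TTheory GRing.Theory Num.Theory.
Import numFieldNormedType.Exports.

Local Open Scope classical_set_scope.
Local Open Scope ring_scope.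

(** * Lattice structure of the unit ball of [Lip0 M] *)

Section lip0_lattice.
Context {R : realType} {M : pointedMetricType R}.
Implicit Types (f g h : Lip0 M) (S : set M).

Lemma lip0_ballP f : `|f| <= 1 <-> forall x y, f x - f y <= mdist x y.
Proof.
split=> [f1 x y|f1].
  rewrite (le_trans (ler_norm _))// (le_trans (lip_normP _ _ _))//.
  by rewrite -[leRHS]mul1r ler_wpM2r// mdist_ge0.
apply: lip_norm_le => // x y; rewrite mul1r ler_norml f1 andbT.
by rewrite lerNl opprB metric_sym.
Qed.

Lemma lip0_exists (h : M -> R) : h point = 0 ->
  (forall x y, h x - h y <= mdist x y) ->
  exists2 f : Lip0 M, `|f| <= 1 & forall x, f x = h x.
Proof.
move=> h0 h1; have hP : h \in lip0_pred (M:=M).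
  apply/asboolP; split=> //; exists 1 => x y; rewrite mul1r ler_norml h1 andbT.
  by rewrite lerNl opprB metric_sym.
by exists (MkLip0 hP) => //; apply/lip0_ballP.
Qed.

Lemma lip0_ball_bound f x : `|f| <= 1 -> `|f x| <= mdist x point.
Proof.
move=> f1; have := lip_normP f x point; rewrite lip0_base subr0 => /le_trans.
by apply; rewrite -[leRHS]mul1r ler_wpM2r// mdist_ge0.
Qed.

Lemma lip0_max_subproof f g :
  (fun x => Num.max (f x) (g x)) \in lip0_pred (M:=M).
Proof.
apply/asboolP; split; first by rewrite !lip0_base maxxx.
exists (`|f| + `|g|) => x y.
have := lip_normP f x y; have := lip_normP g x y.
rewrite -!lip0_normE mulrDl !ler_norml.
move: (`|f| * _) (`|g| * _) => a b; rewrite !maxEle.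
by do 2 case: ifP; lra.
Qed.

Definition lip0_max f g : Lip0 M := MkLip0 (lip0_max_subproof f g).

(** Defining the minimum by subtraction makes the sum of maximum and minimum equal to [f + g] by
    linear algebra, the form in which a functional is applied to it. *)
Definition lip0_min f g : Lip0 M := f + g - lip0_max f g.

Lemma lip0_minE f g x : lip0_min f g x = Num.min (f x) (g x).
Proof.
apply: (addIr (Num.max (f x) (g x))); rewrite addr_min_max.
by rewrite /lip0_min /= !fctE subrK.
Qed.

Lemma lip0_max_ball f g : `|f| <= 1 -> `|g| <= 1 -> `|lip0_max f g| <= 1.
Proof.
move=> /lip0_ballP f1 /lip0_ballP g1; apply/lip0_ballP => x y /=.
have := f1 x y; have := g1 x y; rewrite !maxEle.
by do 2 case: ifP; lra.
Qed.

Lemma lip0_min_ball f g : `|f| <= 1 -> `|g| <= 1 -> `|lip0_min f g| <= 1.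
Proof.
move=> /lip0_ballP f1 /lip0_ballP g1; apply/lip0_ballP => x y.
rewrite !lip0_minE; have := f1 x y; have := g1 x y; rewrite !minEle.
by do 2 case: ifP; lra.
Qed.

(** The set over which the supremum [s(S)] of [phi] is taken. *)
Definition lip_cone S : set (Lip0 M) :=
  [set f : Lip0 M |
    [/\ `|f| <= 1, forall x, 0 <= f x & forall x, S x -> f x = 0]].

Lemma lip_cone0 S : lip_cone S 0.
Proof. by split=> //; rewrite normr0. Qed.

Lemma lip_coneS S T : S `<=` T -> lip_cone T `<=` lip_cone S.
Proof. by move=> ST f [f1 f0 fT]; split=> // x /ST; exact: fT. Qed.

Lemma lip_cone_max S f g : lip_cone S f -> lip_cone S g ->
  lip_cone S (lip0_max f g).
Proof.
move=> [f1 f0 fS] [g1 g0 gS]; split=> [|x|x Sx]; first exact: lip0_max_ball.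
- by rewrite /= le_max f0.
- by rewrite /= fS// gS// maxxx.
Qed.

(** As [f] is nonnegative, the zeros of [g] pass to the minimum; this cuts a running maximum down to
    the cone of a later set. *)
Lemma lip_cone_min S f g : `|f| <= 1 -> (forall x, 0 <= f x) ->
  lip_cone S g -> lip_cone S (lip0_min f g).
Proof.
move=> f1 f0 [g1 g0 gS]; split=> [|x|x Sx]; first exact: lip0_min_ball.
- by rewrite lip0_minE le_min f0 g0.
- by rewrite lip0_minE gS// min_r.
Qed.

End lip0_lattice.

(** * Smallness of normal functionals on functions vanishing on a finite set *)

Section normal_functional.
Context {R : realType} {M : pointedMetricType R}.
Implicit Types (phi : dual (Lip0 M)) (S : nat -> set M).

Definition dyadic (k : nat) : R := 2^-1 ^+ k.

Lemma dyadic_gt0 k : 0 < dyadic k.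
Proof. by rewrite /dyadic exprn_gt0. Qed.

Lemma dyadicS k : dyadic k = 2 * dyadic k.+1.
Proof. by rewrite /dyadic exprS mulrA divff// mul1r. Qed.

Lemma cvg_dyadic : dyadic @ \oo --> 0.
Proof. by apply: cvg_expr; rewrite ger0_norm// invf_lt1// ltr1n. Qed.

(** In the unit ball the values at each point are bounded, so monotone sequences converge pointwise;
    the Lipschitz bound passes to the limit, and normality applies with the natural numbers as index
    set. *)
Lemma normal_monotone_seq phi (f : nat -> Lip0 M) : normal phi ->
    (forall n, `|f n| <= 1) -> monotone_net (fun m n : nat => (m <= n)%N) f ->
  exists g : Lip0 M, [/\ `|g| <= 1, (forall x, f n x @[n --> \oo] --> g x) &
    phi (f n) @[n --> \oo] --> phi g].
Proof.
move=> nphi f1 fmon.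
have fcvg x : cvgn (fun n => f n x).
  have bnd n := lip0_ball_bound x (f1 n).
  case: fmon => mon.
    apply: nondecreasing_is_cvgn => [m n mn|]; first exact: mon.
    by exists (mdist x point) => _ [n _ <-]; exact: le_trans (ler_norm _) _.
  apply: nonincreasing_is_cvgn => [m n mn|]; first exact: mon.
  exists (- mdist x point) => _ [n _ <-]; have := bnd n.
  by rewrite ler_norml => /andP[].
have [|x y|g g1 gE] := @lip0_exists R M (fun x => limn (fun n => f n x)).
- under eq_fun do rewrite lip0_base.
  by rewrite lim_cst.
- rewrite -limB; [|exact: fcvg|exact: fcvg]; apply: limr_le.
    by apply: is_cvgB; exact: fcvg.
  by apply: nearW => n; exact: (lip0_ballP (f n)).1.
have fg x : f n x @[n --> \oo] --> g x by rewrite gE; exact: fcvg.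
exists g; split=> //.
apply: (nphi nat (fun m n : nat => (m <= n)%N) f g) => //.
- split=> [|i|i j k|i j]; [|exact: leqnn|exact: leq_trans|].
    exact: (inhabits 0%N).
  by exists (maxn i j); rewrite leq_maxl leq_maxr.
- by exists 1.
Qed.

Fixpoint run_max (f : nat -> Lip0 M) (m n : nat) : Lip0 M :=
  if n is n'.+1 then lip0_max (run_max f m n') (f (m + n)%N) else f m.

Lemma run_max_ge (f : nat -> Lip0 M) m n k x :
  (k <= n)%N -> f (m + k)%N x <= run_max f m n x.
Proof.
elim: n => [|n ih]; first by rewrite leqn0 => /eqP ->; rewrite addn0.
rewrite leq_eqVlt => /orP[/eqP ->|/ih kn] /=; rewrite le_max ?kn//.
by rewrite lexx orbT.
Qed.

Lemma run_max_le (f : nat -> Lip0 M) m n x c :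
  (forall k, (m <= k)%N -> f k x <= c) -> run_max f m n x <= c.
Proof.
by move=> fc; elim: n => [|n ih] /=; rewrite ?ge_max ?ih fc// leq_addr.
Qed.

Lemma run_max_ball (f : nat -> Lip0 M) m n :
  (forall k, `|f k| <= 1) -> `|run_max f m n| <= 1.
Proof. by move=> f1; elim: n => [|n ih] //=; exact: lip0_max_ball. Qed.

Lemma dual_max_min phi (f g : Lip0 M) :
  phi (lip0_max f g) + phi (lip0_min f g) = phi f + phi g.
Proof. by rewrite linearB linearD /= addrC subrK. Qed.

(* Near-maximizers are almost stable under suprema: as [min (u, f k)] vanishes
   on [S k], [phi (max (u, f k)) = phi u + phi (f k) - phi (min (u, f k))]
   falls below [phi u] by at most [2 * dyadic k]. *)
Lemma normal_tail_sup phi S (f : nat -> Lip0 M) (a : R) : normal phi ->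
    (forall k h, lip_cone (S k) h -> phi h <= a + dyadic k) ->
    (forall k, lip_cone (S k) (f k)) -> (forall k, a - dyadic k <= phi (f k)) ->
  forall m, exists g : Lip0 M, [/\ `|g| <= 1,
    (forall k x, (m <= k)%N -> f k x <= g x),
    (forall x c, (forall k, (m <= k)%N -> f k x <= c) -> g x <= c) &
    a - 3 * dyadic m <= phi g].
Proof.
move=> nphi ub fS lb m.
have f1 k : `|f k| <= 1 by case: (fS k).
have umono : monotone_net (fun m n : nat => (m <= n)%N) (run_max f m).
  left=> i j ij x; elim: j ij => [|j ih]; first by rewrite leqn0 => /eqP ->.
  by rewrite leq_eqVlt => /orP[/eqP ->|/ih {}ih]//=; rewrite le_max ih.
have [g [g1 ug phig]] :=
  normal_monotone_seq nphi (fun n => run_max_ball m n f1) umono.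
exists g; split=> //.
- move=> k x mk; apply: (closed_cvg (fun y => f k x <= y)) (ug x).
    exact: closed_ge.
  exists (k - m)%N => // n /= kn.
  by rewrite -{1}(subnKC mk) run_max_ge.
- move=> x c fc; apply: (closed_cvg (fun y => y <= c)) (ug x).
    exact: closed_le.
  by apply: nearW => n; exact: run_max_le.
apply: (closed_cvg (fun y => a - 3 * dyadic m <= y)) phig.
  exact: closed_ge.
apply: nearW => n.
(* The added term is the budget for losses still to come: [2 * dyadic (m + n)] is the sum of
   [2 * dyadic k] over all [k > m + n]. *)
suff : a - 3 * dyadic m + 2 * dyadic (m + n) <= phi (run_max f m n).
  by apply: le_trans; rewrite lerDl mulr_ge0// ltW// dyadic_gt0.
elim: n => [|n ih] /=; first by rewrite addn0; have := lb m; lra.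
have run0 x : 0 <= run_max f m n x.
  by apply: (le_trans _ (run_max_ge f m x (leq0n n))); case: (fS (m + 0)%N).
have := ub _ _ (lip_cone_min (run_max_ball m n f1) run0 (fS (m + n.+1)%N)).
have := dual_max_min phi (run_max f m n) (f (m + n.+1)%N).
have := lb (m + n.+1)%N; have := dyadicS (m + n); rewrite addnS.
by move: ih; lra.
Qed.

(** Normality serves twice: upwards to form each tail supremum [g n], then downwards along the
    decreasing sequence [g], whose limit is the limsup. *)
Lemma normal_limsup phi S (a : R) : normal phi ->
    {homo S : m n / (m <= n)%N >-> m `<=` n} ->
    (forall k h, lip_cone (S k) h -> phi h <= a + dyadic k) ->
    (forall k, exists2 h, lip_cone (S k) h & a - dyadic k <= phi h) ->
  exists2 g, lip_cone (\bigcup_k S k) g & a <= phi g.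
Proof.
move=> nphi Smono ub lb.
have [f fS lbf] : exists2 f : nat -> Lip0 M,
    forall k, lip_cone (S k) (f k) & forall k, a - dyadic k <= phi (f k).
  by exists (fun k => sval (cid2 (lb k))) => k; case: cid2.
have [g /all_and4[g1 fg gub lbg]] := choice (normal_tail_sup nphi ub fS lbf).
have gmono : monotone_net (fun m n : nat => (m <= n)%N) g.
  right=> i j ij x; apply: gub => k jk; apply: fg; exact: leq_trans jk.
have [l [l1 gl phil]] := normal_monotone_seq nphi g1 gmono.
exists l; last first.
  have : phi (g n) + 3 * dyadic n @[n --> \oo] --> phi l + 3 * 0.
    by apply: cvgD phil _; exact: cvgMl_tmp cvg_dyadic.
  rewrite mulr0 addr0; apply: (closed_cvg (fun y => a <= y)).
    exact: closed_ge.
  by apply: nearW => n; have := lbg n; lra.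
have g0 n x : 0 <= g n x.
  by apply: le_trans (fg n n x (leqnn n)); case: (fS n).
split=> // [x|x [k _ Skx]].
  apply: (closed_cvg (fun y : R => 0 <= y)) (gl x); first exact: closed_ge.
  exact: nearW.
apply: (closed_cvg (fun y : R => y = 0)) (gl x); first exact: closed_eq.
(* From index [k] on, all functions in the tail vanish at [x] because the sets increase, so [g n x]
   is squeezed to [0]. *)
exists k => // n /= kn; apply: le_anti; rewrite g0 andbT.
apply: gub => j nj; case: (fS j) => _ _ ->//.
by apply: Smono Skx; exact: leq_trans nj.
Qed.

Lemma normal_le0 phi (Z : set (Lip0 M)) (a : R) : normal phi ->
    (forall f, Z f -> [/\ `|f| <= 1, (forall x, 0 <= f x) & a <= phi f]) ->
    (forall f g, Z f -> Z g -> Z (lip0_min f g)) ->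
    (forall x, exists2 f, Z f & f x = 0) ->
  a <= 0.
Proof.
move=> nphi Zb Zmin Z0.
(* The set [Z] indexes the net by itself, a smaller function being a later index; minima provide
   upper bounds. *)
pose I := {f | Z f}; pose le (i j : I) := forall x, sval j x <= sval i x.
have dir : directed le.
  split=> [|i x|i j k ij jk x|[f Zf] [g Zg]].
  - by have [f Zf _] := Z0 point; exact: (inhabits (exist _ f Zf)).
  - exact: lexx.
  - exact: le_trans (jk x) (ij x).
  - exists (exist _ _ (Zmin _ _ Zf Zg)).
    by split=> x; rewrite [leLHS]lip0_minE ge_min lexx ?orbT.
have pf := eventually_along_proper dir.
have cvg0 x :
    (sval i : Lip0 M) x @[i --> eventually_along le] --> (0 : Lip0 M) x.
  (* Beyond a member [f] vanishing at [x], every member of the net is pinned to [0] at [x]. *)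
  apply/cvgrPdist_le => e e0; have [f Zf fx] := Z0 x.
  exists (exist _ f Zf) => // -[g Zg] /= /(_ x) /=; rewrite fx => gx.
  have [_ /(_ x) g0 _] := Zb _ Zg.
  have -> : g x = 0 :> R by apply: le_anti; rewrite gx g0.
  by rewrite subrr normr0 ltW.
have phi0 : phi (sval i) @[i --> eventually_along le] --> phi 0.
  apply: nphi => //; last by right.
  by exists 1 => -[f /= /Zb[]].
rewrite -(linear0 phi); apply: (closed_cvg (fun y : R => a <= y)) phi0.
  exact: closed_ge.
by apply: nearW => -[f /= /Zb[]].
Qed.

Lemma normal_cone_small phi (e : R) : normal phi -> 0 < e ->
  exists F : seq M, forall f, lip_cone [set` F] f -> phi f <= e.
Proof.
move=> nphi e0.
pose V (F : seq M) := [set phi f | f in lip_cone [set` F]].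
have phib T (f : Lip0 M) : lip_cone T f -> phi f <= dual_norm phi.
  move=> [f1 _ _]; apply: (le_trans (ler_norm _)).
  apply: (le_trans (dual_normP _ _)).
  by rewrite -[leRHS]mulr1 ler_wpM2l// dual_norm_ge0.
have V0 F : V F 0 by exists 0; [exact: lip_cone0|rewrite linear0].
have Vub F : has_ubound (V F).
  by exists (dual_norm phi) => _ [f /phib ? <-].
have Vsup F : has_sup (V F) by split=> //; exists 0.
pose A := range (fun F => sup (V F)).
have Ainf : has_inf A.
  split; first by exists (sup (V [::])), [::].
  by exists 0 => _ [F _ <-]; exact: ub_le_sup.
have lb (F : seq M) d : 0 < d ->
    exists2 h, lip_cone [set` F] h & inf A - d <= phi h.
  move=> d0; have [_ [h hF <-] hd] := sup_adherent d0 (Vsup F).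
  exists h => //; rewrite (le_trans _ (ltW hd))// lerD2r.
  by apply: ge_inf; [case: Ainf|exists F].
suff a0 : inf A <= 0.
  have [_ [F _ <-] Fe] := inf_adherent e0 Ainf.
  exists F => f fF.
  have : phi f <= sup (V F) by apply: ub_le_sup => //; exists f.
  lra.
have /choice[F Fw] k : exists F, sup (V F) < inf A + dyadic k.
  by have [_ [F _ <-]] := inf_adherent (dyadic_gt0 k) Ainf; exists F.
(* The near-optimal sets [F k] need not be nested; accumulating them gives an increasing sequence
   and can only lower the suprema. *)
pose G k := flatten [seq F j | j <- iota 0 k.+1].
have GP k x : reflect (exists2 j, (j <= k)%N & x \in F j) (x \in G k).
  apply: (iffP flatten_mapP) => -[j];
    rewrite ?mem_iota => jk xF; exists j => //.
  by rewrite mem_iota.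
have Gmono m n x : (m <= n)%N -> x \in G m -> x \in G n.
  move=> mn /GP[j jm xF]; apply/GP; exists j => //; exact: leq_trans mn.
have ub k h : lip_cone [set` G k] h -> phi h <= inf A + dyadic k.
  move=> hG; apply: le_trans (ltW (Fw k)); apply: ub_le_sup => //.
  exists h => //; apply: lip_coneS hG => x /= xF; apply/GP; exists k => //.
pose U := \bigcup_k [set` G k].
have ubU h : lip_cone U h -> phi h <= inf A.
  move=> hU; have : inf A + dyadic n @[n --> \oo] --> inf A + 0.
    by apply: cvgD cvg_dyadic; exact: cvg_cst.
  rewrite addr0; apply: (closed_cvg (fun y => phi h <= y)).
    exact: closed_ge.
  by apply: nearW => n; apply: ub; apply: lip_coneS hU => x xG; exists n.
(* Adding [x] to every [G k] keeps the upper bounds, since the cones shrink, and the lower bounds,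
   since [inf A] ranges over all finite sets. *)
have attained x : exists2 g, lip_cone (U `|` [set x]) g & inf A <= phi g.
  have [|k h hx|k|g gS ag] :=
    @normal_limsup phi (fun k => [set` x :: G k]) (inf A) nphi.
  - move=> m n mn y /=; rewrite !inE => /orP[->//|/(Gmono _ _ _ mn) ->].
    by rewrite orbT.
  - by apply: ub; apply: lip_coneS hx => y /=; rewrite inE => ->; rewrite orbT.
  - exact: lb (dyadic_gt0 k).
  - exists g => //; apply: lip_coneS gS => y [[k _ /= yG]|->]; last first.
      by exists 0%N => //=; rewrite inE eqxx.
    by exists k => //=; rewrite inE yG orbT.
apply: (@normal_le0 phi [set f | lip_cone U f /\ inf A <= phi f]) => //.
- by move=> f [[]].
- move=> f g [fU af] [gU ag]; split.
    by case: (fU) => f1 f0 _; exact: lip_cone_min.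
  (* The maximum stays in the cone of [U], so its value is at most [inf A]; this forces the minimum
     to have value at least [inf A]. *)
  have := ubU _ (lip_cone_max fU gU); have := dual_max_min phi f g.
  lra.
- move=> x; have [g gU ag] := attained x; exists g.
    by split=> //; apply: lip_coneS gU; left.
  by case: gU => _ _ -> //; right.
Qed.

End normal_functional.

(** * Linear spans and norm closure *)

Section linear_span.
Context {R : realType} {V : normedModType R}.
Implicit Types (A : set V) (u v : V).

Lemma linear_span0 A : linear_span A 0.
Proof.
exists 0%N, (fun=> 0), (fun=> 0).
by split=> [[]//|]; rewrite big_ord0.
Qed.

Lemma linear_spanD A c a v : A a -> linear_span A v ->
  linear_span A (c *: a + v).
Proof.
move=> Aa [n [d [b [Ab ->]]]].
exists n.+1, (fun i => oapp d c (unlift ord0 i)),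
  (fun i => oapp b a (unlift ord0 i)).
split=> [i|]; first by case: (unlift ord0 i) => [j|]; [exact: Ab|exact: Aa].
rewrite big_ord_recl unlift_none; congr (_ + _).
by apply: eq_bigr => i _; rewrite liftK.
Qed.

Lemma closure_normP (A : set V) v :
  closure A v <-> forall e : R, 0 < e -> exists2 u, A u & `|v - u| <= e.
Proof.
split=> [clA e e0|near_A B /nbhs_ballP[e /= e0 eB]].
  have [u []] := clA _ (nbhsx_ballx v e e0).
  by rewrite -ball_normE /= => Au /ltW; exists u.
have [|u Au vu] := near_A (e / 2); first by rewrite divr_gt0.
exists u; split=> //; apply: eB; rewrite -ball_normE /=; lra.
Qed.

End linear_span.

(** * Normality, membership in the free space and weak* continuity *)

Section normal_lipfree.
Context {R : realType} {M : pointedMetricType R}.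
Implicit Types (phi psi : dual (Lip0 M)).

(** Both parts are nonnegative and vanish wherever [f] does, so bounds on cones extend to functions
    of any sign. *)
Lemma lip0_pos_neg (f : Lip0 M) : f = lip0_max f 0 - lip0_max (- f) 0.
Proof.
apply: val_inj; apply/funext => x /=; rewrite !fctE /=.
rewrite -[(0 : M -> R) x]/(0 : R) !maxEle oppr_le0.
by do 2 case: ifP; lra.
Qed.

(** [normal_cone_small] bounds only from above; applied to [- phi] it also bounds [phi] from
    below. *)
Lemma normalN phi : normal phi -> normal (- phi).
Proof.
move=> nphi I le f g dir bnd mon fg.
have pf := eventually_along_proper dir.
by apply: (@cvgN _ R); exact: nphi.
Qed.

Lemma normal_small phi (e : R) : normal phi -> 0 < e ->
  exists F : seq M, forall f : Lip0 M,
    (forall x, x \in F -> f x = 0) -> `|phi f| <= e * `|f|.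
Proof.
move=> nphi e0.
have e20 : 0 < e / 2 by rewrite divr_gt0.
have [F1 F1e] := normal_cone_small nphi e20.
have [F2 F2e] := normal_cone_small (normalN nphi) e20.
exists (F1 ++ F2) => f fF.
have [->|f0] := eqVneq f 0; first by rewrite linear0 !normr0 mulr0.
pose g := `|f|^-1 *: f.
have fE : f = `|f| *: g by rewrite scalerA divff ?normr_eq0// scale1r.
have g1 : `|g| <= 1 by rewrite normrZ normfV normr_id mulVf// normr_eq0.
have gF x : x \in F1 ++ F2 -> g x = 0.
  by move=> xF; rewrite /g /= !fctE fF// scaler0.
clearbody g; suff phig : `|phi g| <= e.
  by rewrite {1}fE linearZ /= normrM normr_id mulrC ler_wpM2r.
have cone (h : Lip0 M) : `|h| <= 1 -> (forall x, x \in F1 ++ F2 -> h x = 0) ->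
    lip_cone [set` F1 ++ F2] (lip0_max h 0).
  move=> h1 hF; split=> [|x|x /= /hF ->]; last exact: maxxx.
    by apply: lip0_max_ball => //; rewrite normr0.
  by rewrite /= le_max lexx orbT.
have bound (h : Lip0 M) : lip_cone [set` F1 ++ F2] h -> `|phi h| <= e / 2.
  move=> hc; rewrite ler_norml lerNl.
  rewrite F1e ?andbT.
    apply: F2e; apply: lip_coneS hc => x /=.
    by rewrite mem_cat => ->; rewrite orbT.
  by apply: lip_coneS hc => x /=; rewrite mem_cat => ->.
rewrite (lip0_pos_neg g) linearB /= (le_trans (ler_normB _ _))//.
rewrite [leRHS](splitr e) lerD// bound//.
  exact: cone.
by apply: cone => [|x xF]; rewrite ?normrN//= !fctE gF// oppr0.
Qed.

(* One-dimensional Hahn-Banach step: [c] separates the values [phi f - e |f|]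
   from the values [phi f + e |f|] over the [f] in [W] with [f x = 1]. *)
Lemma hahn_banach_step phi (W : set (Lip0 M)) (x : M) (e : R) : 0 <= e ->
    (forall f g, W f -> W g -> W (f - g)) -> (forall a f, W f -> W (a *: f)) ->
    (forall f, W f -> f x = 0 -> `|phi f| <= e * `|f|) ->
  exists c, forall f, W f -> `|(phi - c *: delta x) f| <= e * `|f|.
Proof.
move=> e0 WB WZ phiW.
pose A := [set phi f - e * `|f| | f in [set f : Lip0 M | W f /\ f x = 1]].
have cross (f g : Lip0 M) : W f -> f x = 1 -> W g -> g x = 1 ->
    phi f - e * `|f| <= phi g + e * `|g|.
  move=> Wf f1 Wg g1.
  have := phiW (f - g) (WB _ _ Wf Wg); rewrite /= !fctE f1 g1 subrr.
  move=> /(_ erefl) /(le_trans (ler_norm _)); rewrite linearB /=.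
  have : e * `|f - g| <= e * (`|f| + `|g|) by rewrite ler_wpM2l// ler_normB.
  lra.
exists (sup A) => f Wf; rewrite /= !fctE -[_ *: _]/(sup A * f x).
have [fx|fx] := eqVneq (f x) 0; first by rewrite fx mulr0 subr0 phiW.
pose g := (f x)^-1 *: f.
have Wg : W g by exact: WZ.
have g1 : g x = 1 by rewrite /= !fctE -[_ *: _]/(_ * _) mulVf.
have fE : f = f x *: g by rewrite scalerA divff// scale1r.
have lb : phi g - e * `|g| <= sup A.
  apply: ub_le_sup; last by exists g.
  by exists (phi g + e * `|g|) => _ [h [Wh h1] <-]; exact: cross.
have ub : sup A <= phi g + e * `|g|.
  apply: ge_sup; first by exists (phi g - e * `|g|), g.
  by move=> _ [h [Wh h1] <-]; exact: cross.
rewrite {1 3}fE linearZ normrZ /= [sup A * _]mulrC -mulrBr normrM mulrCA.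
by rewrite ler_wpM2l// ler_norml; lra.
Qed.

(** Each Hahn-Banach step removes one point of [F] by subtracting a multiple of its evaluation, with
    the same [e]; once [F] is empty the bound is one on the dual norm. *)
Lemma span_delta_approx phi (F : seq M) (e : R) : 0 <= e ->
    (forall f : Lip0 M, (forall x, x \in F -> f x = 0) ->
      `|phi f| <= e * `|f|) ->
  exists2 psi, linear_span (range (@delta R M)) psi & `|phi - psi| <= e.
Proof.
move=> e0; elim: F phi => [|x F ih] phi phiF.
  exists 0; first exact: linear_span0.
  by rewrite subr0; apply: dual_norm_le => // f; exact: phiF.
have [||f fF fx|c phic] :=
  @hahn_banach_step phi [set f : Lip0 M | forall y, y \in F -> f y = 0] x e e0.
- by move=> f g fF gF y yF; rewrite /= !fctE fF// gF// subrr.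
- by move=> a f fF y yF; rewrite /= !fctE fF// scaler0.
- by apply: phiF => y; rewrite inE => /orP[/eqP -> //|/fF].
have [psi psiF phipsi] := ih _ phic.
exists (c *: delta x + psi); last by rewrite opprD addrA.
by apply: linear_spanD.
Qed.

Lemma normal_lipfree phi : normal phi -> lipfree M phi.
Proof.
move=> nphi; apply/closure_normP => e e0.
have [F phiF] := normal_small nphi e0.
exact: span_delta_approx (ltW e0) phiF.
Qed.

(** Finite combinations of evaluations respect pointwise convergence, and on a bounded net the error
    of a norm approximation is uniform. *)
Lemma lipfree_normal phi : lipfree M phi -> normal phi.
Proof.
move=> /closure_normP phiM I le f g dir [C fC] _ fg.
have pf := eventually_along_proper dir.
apply/cvgrPdist_le => e e0.
(* [K] bounds the norm of [g - f i] for every [i]; the [1] makes it positive, so that it can be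
   divided by. *)
pose K := `|C| + `|g| + 1.
have K0 : 0 < K by rewrite ltr_pwDr// addr_ge0.
have [|psi [n [c [a [aM psiE]]]] phipsi] := phiM (e / 2 / K).
  by rewrite !divr_gt0.
have psi_cvg : psi (f i) @[i --> eventually_along le] --> psi g.
  pose cvgf (u : dual (Lip0 M)) := u (f i) @[i --> eventually_along le] --> u g.
  rewrite psiE; apply: (big_ind cvgf) => [|u v|i _].
  - exact: cvg_cst.
  - exact: (@cvgD _ R).
  - by apply: cvgMl_tmp; have [x _ <-] := aM i; exact: fg.
have e20 : 0 < e / 2 by rewrite divr_gt0.
move/cvgrPdist_le : psi_cvg => /(_ _ e20); apply: filterS => i psii.
have -> : phi g - phi (f i) = (phi - psi) (g - f i) + (psi g - psi (f i)).
  by rewrite !linearB /= !fctE; lra.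
rewrite (le_trans (ler_normD _ _))// [leRHS](splitr e) lerD//.
rewrite (le_trans (dual_normP _ _))//.
have -> : e / 2 = e / 2 / K * K by rewrite divfK// gt_eqF.
apply: ler_pM => //; first exact: dual_norm_ge0.
rewrite (le_trans (ler_normB _ _))// addrC /K -addrA lerD//.
  by rewrite (le_trans (fC i))// ler_norm.
by rewrite lerDl.
Qed.

Lemma lipfree_weak_star_continuous phi :
  lipfree M phi -> weak_star_continuous phi.
Proof.
move=> phiM.
pose ev (f : Lip0 M) : {ptws (lipfree M) -> R} :=
  fun q => (val q : dual (Lip0 M)) f.
pose p : lipfree M := SigSub (mem_set phiM).
(* [phi] is the embedding into the product followed by the projection to the coordinate [phi]. *)
move=> f; apply: (@continuous_comp (weak_star M) _ _ ev (fun h => h p)).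
  exact: initial_continuous.
exact: proj_continuous.
Qed.

(** Elements of the free space are normal, so the net converges in every coordinate defining the
    weak* topology, hence weak*. *)
Lemma weak_star_continuous_normal phi : weak_star_continuous phi -> normal phi.
Proof.
move=> phic I le f g dir bnd mon fg.
have pf := eventually_along_proper dir.
suff : f i @[i --> eventually_along le] --> (g : weak_star M).
  by move=> fgw; exact: (cvg_comp (f : I -> weak_star M) _ fgw (phic g)).
pose ev (h : Lip0 M) : {ptws (lipfree M) -> R} :=
  fun q => (val q : dual (Lip0 M)) h.
have evfg : ev (f i) @[i --> eventually_along le] --> ev g.
  (* Convergence in the product is checked coordinatewise; constant families show that each
     projection is onto. *)
  apply/cvg_sup => q; apply/cvg_image.
    by rewrite eqEsubset; split=> v // _; exists (cst v).
  have qM : lipfree M (val q) by exact: set_mem (valP q).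
  have := lipfree_normal qM dir bnd mon fg.
  apply: cvg_trans => W /= nW; exists (@^~ q @^-1` W) => //.
  by rewrite image_preimage // eqEsubset; split=> // v _; exists (cst v).
move=> U [W [[B oB <-]] Bg /filterS]; apply.
by apply: evfg; exact: open_nbhs_nbhs.
Qed.

End normal_lipfree.

Theorem theorem2 (R : realType) (M : completePointedMetricType R)
    (phi : dual (Lip0 M)) :
  (normal phi <-> weak_star_continuous phi) /\
  (normal phi <-> lipfree M phi).
Proof.
split; split.
- by move=> /normal_lipfree; exact: lipfree_weak_star_continuous.
- exact: weak_star_continuous_normal.
- exact: normal_lipfree.
- exact: lipfree_normal.
Qed.
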